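(* Let $k_3,k_5>0$ and $k\in\mathbb{R}$, and consider on $\mathbb{R}^3_+=\{(x,y,z):x,y,z\ge 0\}$ the system $$x'=kx-xy,\qquad y'=k_3(z-y),\qquad z'=k_5(x-z).$$ This system has a non-empty compact invariant set $A\subset\mathbb{R}^3_+$ that attracts all bounded subsets of $\mathbb{R}^3_+$. If $k\le 0$, then $A=\{0\}$. If $k>0$, then $A\subset[0,M]^3$, where $$M=\frac{k(k+k_5)(k+k_3)}{k_3k_5}.$$
   Context: Let $\phi(t,p)$, $t\ge0$, denote the solution of the system starting at $p\in\mathbb{R}^3_+$ at $t=0$. A set $A$ is invariant if $\phi(t,A)=A$ for all $t\ge 0$. A set $A$ attracts a set $B$ if $\sup_{p\in B}\operatorname{dist}(\phi(t,p),A)\to 0$ as $t\to\infty$. *)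

(* Defs.v *)
From HB Require Import structures.
From mathcomp Require Import all_boot all_order all_algebra.
From mathcomp Require Import all_classical all_reals all_analysis.

Set Implicit Arguments.
Unset Strict Implicit.
Unset Printing Implicit Defensive.
Import Order.TTheory GRing.Theory Num.Theory.
Import numFieldNormedType.Exports.

Local Open Scope classical_set_scope.
Local Open Scope ring_scope.

(* A point (x, y, z) is the row vector p with x = p 0 0, y = p 0 1, z = p 0 2. *)
Definition orthant (R : realType) : set 'rV[R]_3 :=
  [set p : 'rV[R]_3 | forall i, 0 <= p 0 i].

(* Forward solutions in the orthant; values of u at negative times are
   irrelevant. At t = 0 only continuity is required: since the right-hand side
   is continuous, the one-sided derivative at 0 then satisfies the equations
   as well. *)
Definition solution (R : realType) (k k3 k5 : R) (p : 'rV[R]_3)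
    (u : R -> 'rV[R]_3) : Prop :=
  [/\ u 0 = p,
      (forall t : R, 0 <= t -> orthant (u t)),
      {within `[0, +oo[, continuous u} &
      (forall t : R, 0 < t ->
        [/\ is_derive t 1 (fun s => u s 0 0) (k * u t 0 0 - u t 0 0 * u t 0 1),
            is_derive t 1 (fun s => u s 0 1) (k3 * (u t 0 2 - u t 0 1)) &
            is_derive t 1 (fun s => u s 0 2) (k5 * (u t 0 0 - u t 0 2))])].

(* phi(t, p), by definite description. The default value (the constant curve)
   is never used for p in the orthant and k3, k5 > 0: a solution from p exists
   and is unique on [0, +oo[. *)
Definition flow (R : realType) (k k3 k5 : R) (t : R) (p : 'rV[R]_3) :
    'rV[R]_3 :=
  xget (fun=> p) [set u | solution k k3 k5 p u] t.

Definition invariant_set (R : realType) (phi : R -> 'rV[R]_3 -> 'rV[R]_3)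
    (A : set 'rV[R]_3) : Prop :=
  forall t : R, 0 <= t -> phi t @` A = A.

(* Distances are for the sup norm of 'rV[R]_3, equivalent to the Euclidean one.
   The supremum is taken in [0, +oo], whence the added 0 (it matters only for
   B = set0, where ereal_sup alone would give -oo). *)
Definition attracts (R : realType) (phi : R -> 'rV[R]_3 -> 'rV[R]_3)
    (A B : set 'rV[R]_3) : Prop :=
  ereal_sup (0%E |` [set edist_inf A (phi t p) | p in B]) @[t --> +oo]
    --> (0%E : \bar R).

(* Main.v *)
Require Import Defs.
From HB Require Import structures.
From mathcomp Require Import all_boot all_order all_algebra.
From mathcomp Require Import all_classical all_reals all_analysis.
From mathcomp Require Import ring lra.

Set Implicit Arguments.
Unset Strict Implicit.
Unset Printing Implicit Defensive.
Import Order.TTheory GRing.Theory Num.Theory.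
Import numFieldNormedType.Exports.

Local Open Scope classical_set_scope.
Local Open Scope ring_scope.

(** With x' = (k - y) x, the variable y limits the growth of x,
but only through the chain x -> z -> y of two linear relaxations.  A bounded
growth rate of x makes this delayed feedback as effective as an immediate one.
Put K = max(k, 0), alpha = k5 / (K + k5) and c = alpha k3 / (K + k3).  As x
grows at most like exp(K t), the values of z and y that x leaves behind are,
in the long run, at least alpha x and c x.  In differential form

  (z - alpha x)' >= - k5 (z - alpha x),
  (y - c x)' >= - k3 (y - c x) + k3 (z - alpha x),

where the only nonlinear terms, alpha x y and c x y, have been dropped because
they are nonnegative.  Both left-hand sides are thus eventually at least -e,
uniformly for bounded sets of initial points; then x' <= x (K + e - c x)
brings x below K / c + e, and z and y follow since z relaxes to x and y to z
(the lemmas eventually_z_ge, eventually_y_ge, eventually_x_le and their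
companions).  The number K / c is the bound M of the theorem if k > 0, and is
0 if k <= 0.

Hence the cube of side K / c + 1 absorbs bounded sets, and a compact absorbing
set yields an attractor for any continuous semigroup
(attractor_of_absorbing): the points of the cube whose forward orbits stay in
it form a compact set N, the images of N under the flow decrease, and their
intersection is the attractor.  Every point of it lies in the image of the
cube at all times, so the asymptotic bound K / c + e holds on it for all
e > 0.

The flow exists because y determines x, then z, then y again by explicit
formulas; the resulting self-map keeps y nonnegative and is a contraction on
each [0, T] for a norm weighted by exp(- l t) (feedback_contracting).  For two
solutions the squared distance satisfies E' <= L E, which gives uniqueness and
continuity in the initial point (solution_sqdist). *)

(** * Calculus on the closed half-line *)

Section RayCalculus.
Variable R : realType.
Implicit Types (f g df dg : R -> R) (a b s t r : R).

(** The regularity that a component of a solution has: at 0 only continuity is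
required, and the values at negative times do not matter. *)
Definition raydiff f df : Prop :=
  {within `[0, +oo[, continuous f} /\ forall t, 0 < t -> is_derive t 1 f (df t).

Lemma raydiff_ext f df dg : raydiff f df -> (forall t, 0 < t -> df t = dg t) ->
  raydiff f dg.
Proof. by case=> fc fd e; split=> // t t0; rewrite -e//; exact: fd. Qed.

Lemma raydiff_cst a : raydiff (fun=> a) (fun=> 0).
Proof.
split; first by apply: continuous_subspaceT => x; exact: cvg_cst.
by move=> t _; exact: is_derive_cst.
Qed.

Lemma raydiff_id : raydiff id (fun=> 1).
Proof.
split; first by apply: continuous_subspaceT => x; exact: cvg_id.
by move=> t _; exact: is_derive_id.
Qed.

Lemma raydiffD f g df dg : raydiff f df -> raydiff g dg ->
  raydiff (fun t => f t + g t) (fun t => df t + dg t).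
Proof.
move=> [fc fd] [gc gd]; split; first by move=> x; exact: (cvgD (fc x) (gc x)).
by move=> t t0; have ? := fd t t0; have ? := gd t t0; exact: is_deriveD.
Qed.

Lemma raydiffN f df : raydiff f df -> raydiff (fun t => - f t) (fun t => - df t).
Proof.
move=> [fc fd]; split; first by move=> x; exact: (cvgN (fc x)).
by move=> t t0; have ? := fd t t0; exact: is_deriveN.
Qed.

Lemma raydiffB f g df dg : raydiff f df -> raydiff g dg ->
  raydiff (fun t => f t - g t) (fun t => df t - dg t).
Proof. by move=> ? ?; apply: raydiffD => //; exact: raydiffN. Qed.

Lemma raydiffM f g df dg : raydiff f df -> raydiff g dg ->
  raydiff (fun t => f t * g t) (fun t => df t * g t + f t * dg t).
Proof.
move=> [fc fd] [gc gd]; split; first by move=> x; exact: (cvgM (fc x) (gc x)).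
move=> t t0; have ? := fd t t0; have ? := gd t t0.
have -> : df t * g t + f t * dg t = f t *: dg t + g t *: df t.
  by rewrite addrC [df t * _]mulrC.
exact: (@is_deriveM _ _ f g).
Qed.

Lemma raydiffZ a f df : raydiff f df ->
  raydiff (fun t => a * f t) (fun t => a * df t).
Proof.
move=> fd; apply: raydiff_ext (raydiffM (raydiff_cst a) fd) _ => t _ /=.
by rewrite mul0r add0r.
Qed.

Lemma raydiff_expR f df : raydiff f df ->
  raydiff (fun t => expR (f t)) (fun t => df t * expR (f t)).
Proof.
move=> [fc fd]; split.
  by move=> x; apply: (continuous_comp (fc x)); exact: continuous_expR.
move=> t t0; have ? := fd t t0.
by rewrite mulrC; exact: (@is_derive1_comp _ expR f).
Qed.

Lemma raydiff_expZ a : raydiff (fun t => expR (a * t)) (fun t => a * expR (a * t)).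
Proof.
apply: raydiff_ext (raydiff_expR (raydiffZ a raydiff_id)) _ => t _ /=.
by rewrite mulr1.
Qed.

Lemma raydiff_nincr f df s t : raydiff f df -> 0 <= s -> s <= t ->
  (forall r, s < r -> r < t -> df r <= 0) -> f t <= f s.
Proof.
move=> [fc fd] s0 st df0.
have d r : r \in `]s, t[ -> is_derive r 1 f (df r).
  by rewrite in_itv/= => /andP[sr _]; apply: fd; exact: le_lt_trans sr.
apply: (@ler0_derive1_le_cc _ f s t) => //.
- by move=> r rst; exact: (@ex_derive _ _ _ _ _ _ _ (d r rst)).
- move=> r /[dup] rst; rewrite derive1E in_itv/= => /andP[sr rt].
  by have ? := d r rst; rewrite derive_val df0.
- apply: continuous_subspaceW fc => r /=.
  by rewrite !in_itv/= andbT => /andP[sr _]; exact: le_trans sr.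
- by rewrite in_itv/= lexx st.
- by rewrite in_itv/= st lexx.
Qed.

(** Gronwall's inequality: (f - c) exp (a r) is nonincreasing.  A negative
[a] is allowed and gives exponential growth bounds. *)
Lemma raydiff_relax f df a c s t : raydiff f df -> 0 <= s -> s <= t ->
  (forall r, s < r -> r < t -> df r <= - a * (f r - c)) ->
  f t <= c + (f s - c) * expR (- a * (t - s)).
Proof.
move=> fd s0 st dle.
have := raydiffM (raydiffB fd (raydiff_cst c)) (raydiff_expZ a).
move=> /raydiff_nincr /(_ s0 st) h.
have {h}/h : forall r, s < r -> r < t ->
    (df r - 0) * expR (a * r) + (f r - c) * (a * expR (a * r)) <= 0.
  move=> r sr rt; rewrite mulrCA mulrA -mulrDl.
  rewrite mulr_le0_ge0 ?expR_ge0//; have := dle r sr rt; lra.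
rewrite -ler_pdivlMr ?expR_gt0// -expRN -mulrA -expRD.
by rewrite (_ : - a * (t - s) = a * s - a * t); [lra | ring].
Qed.

(** A function that decreases at speed e whenever it is above m cannot climb
back above m, so if it is above m at time t it has been decreasing all the
time. *)
Lemma raydiff_trap f df m e s t : raydiff f df -> 0 <= s -> s <= t -> 0 <= e ->
  (forall r, s < r -> r < t -> m < f r -> df r <= - e) ->
  m < f t -> f t <= f s - e * (t - s).
Proof.
move=> fd s0 st e0 dle mft.
have above r : s <= r -> r <= t -> m < f r.
  move=> sr rt; rewrite ltNge; apply/negP => frm.
  (* q is the last time before t at which f <= m; f decreases after q. *)
  pose S := [set q | q <= t /\ f q <= m] `&` `[s, t].
  have S0 : S !=set0 by exists r; split=> //=; rewrite in_itv/= sr.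
  have Sub : has_ubound S by exists t => q [[]].
  have hS : has_sup S by split.
  pose q := sup S.
  have sq : s <= q.
    apply: (le_trans sr); apply: sup_upper_bound => //.
    by split=> //=; rewrite in_itv/= sr.
  have qt : q <= t by apply: ge_sup => // p [[]].
  have fqm : f q <= m.
    rewrite leNgt; apply/negP => mfq.
    have /subspace_continuousP/(_ q) := fd.1.
    rewrite /= in_itv/= andbT => /(_ (le_trans s0 sq)).
    move=> /(cvgr_gt (f q)) /(_ m mfq).
    rewrite near_withinE => -[d/= d0 hd].
    have [p Sp pq] := sup_adherent d0 hS.
    have pleq : p <= q by exact: sup_upper_bound.
    case: Sp => -[pt fpm]; rewrite /= in_itv/= => /andP[sp _].
    have := hd p; rewrite /ball_/= ger0_norm ?subr_ge0// ltrBlDl -ltrBlDr.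
    rewrite pq in_itv/= andbT (le_trans s0 sp) => /(_ isT isT).
    by rewrite ltNge fpm.
  have : f t <= f q.
    apply: (raydiff_nincr fd) => //; first exact: le_trans sq.
    move=> p qp pt; apply: le_trans (_ : - e <= 0); last by rewrite oppr_le0.
    apply: dle => //; first exact: le_lt_trans qp.
    rewrite ltNge; apply/negP => fpm; move: (qp); apply/negP; rewrite -leNgt.
    apply: sup_upper_bound => //; split; first by split=> //; exact: ltW.
    by rewrite /= in_itv/= (ltW pt) andbT; exact: ltW (le_lt_trans sq qp).
  by move=> ftq; have := lt_le_trans mft (le_trans ftq fqm); rewrite ltxx.
have := raydiffD fd (raydiffZ e raydiff_id).
move=> /raydiff_nincr /(_ s0 st) h.
have {h}/h : forall r, s < r -> r < t -> df r + e * 1 <= 0.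
  move=> r sr rt; have := dle r sr rt (above r (ltW sr) (ltW rt)); lra.
lra.
Qed.

Definition prim f t : R := \int[@lebesgue_measure R]_(s in `[0, t]) f s.

Lemma prim0 f : prim f 0 = 0.
Proof. by rewrite /prim set_itv1 Rintegral_set1. Qed.

Lemma raydiff_prim f : {within `[0, +oo[, continuous f} -> raydiff (prim f) f.
Proof.
move=> fc.
have fint T : (@lebesgue_measure R).-integrable `[0, T] (EFin \o f).
  apply: continuous_compact_integrable; first exact: segment_compact.
  apply: continuous_subspaceW fc => r /=.
  by rewrite !in_itv/= andbT => /andP[].
have d t : 0 < t -> is_derive t 1 (prim f) (f t).
  move=> t0.
  have := @continuous_FTC1_closed _ f 0 t (t + 1) _ (fint _) t0.
  rewrite ltrDl ltr01 => /(_ isT) [].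
    move/continuous_within_itvcyP : fc => [+ _]; apply.
    by rewrite in_itv/= t0.
  by move=> dF; rewrite derive1E => <-; exact: derivableP.
split=> //; apply/continuous_within_itvcyP; split.
  move=> t; rewrite in_itv/= andbT => t0.
  apply/differentiable_continuous/derivable1_diffP.
  exact: (@ex_derive _ _ _ _ _ _ _ (d t t0)).
rewrite prim0; apply: cvg_at_right_filter.
exact: (@parameterized_integral_cvg_left _ 0 1).
Qed.

End RayCalculus.

(** * Geometric convergence *)

Section GeometricConvergence.
Variable R : realType.

Lemma cvg_halving (C : R) : C / 2 ^+ n @[n --> \oo] --> (0 : R).
Proof.
rewrite -(mulr0 C); apply: cvgMr; rewrite (_ : (fun n => _) = (fun n => 2^-1 ^+ n)).
  by apply: cvg_expr; rewrite ger0_norm ?invr_ge0// invf_lt1// ltr1n.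
by apply/funext => n; rewrite exprVn.
Qed.

Lemma le0_geometric (a C : R) : (forall n, a <= C / 2 ^+ n) -> a <= 0.
Proof.
move=> h; have cC := cvg_halving C.
have <- : lim (C / 2 ^+ n @[n --> \oo]) = 0 by exact: cvg_lim.
apply: limr_ge; first by apply/cvg_ex; exists 0.
by near=> n; exact: h.
Unshelve. all: by end_near. Qed.

(** The intervals of radius 2 C / 2 ^ n around u n are nested. *)
Lemma geometric_limit (u : nat -> R) (C : R) :
  (forall n, `|u n.+1 - u n| <= C / 2 ^+ n) ->
  forall n, `|u n - lim (u @ \oo)| <= 2 * C / 2 ^+ n.
Proof.
move=> du.
have half n : 2 * C / 2 ^+ n.+1 = C / 2 ^+ n.
  by rewrite exprS -mulf_div divff ?mul1r.
have step n : u n - 2 * C / 2 ^+ n <= u n.+1 - 2 * C / 2 ^+ n.+1 /\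
    u n.+1 + 2 * C / 2 ^+ n.+1 <= u n + 2 * C / 2 ^+ n.
  have := du n; rewrite half ler_norml -mulrA => /andP[]; lra.
have C0 : 0 <= C.
  by have := le_trans (normr_ge0 _) (du 0); rewrite expr0 divr1.
have Cn n : 0 <= 2 * C / 2 ^+ n by rewrite divr_ge0 ?mulr_ge0 ?exprn_ge0.
have lo n m : (n <= m)%N -> u n - 2 * C / 2 ^+ n <= u m - 2 * C / 2 ^+ m.
  apply: (@homo_leq _ (fun i => u i - 2 * C / 2 ^+ i) (fun x y => x <= y)) => //.
    by move=> x y z; exact: le_trans.
  by move=> p; have [] := step p.
have hi n m : (n <= m)%N -> u m + 2 * C / 2 ^+ m <= u n + 2 * C / 2 ^+ n.
  apply: (@homo_leq _ (fun i => u i + 2 * C / 2 ^+ i) (fun x y => y <= x)) => //.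
    by move=> x y z xy zx; exact: le_trans zx xy.
  by move=> p; have [] := step p.
have lohi n m : u n - 2 * C / 2 ^+ n <= u m + 2 * C / 2 ^+ m.
  have := lo n _ (leq_maxl n m); have := hi m _ (leq_maxr n m).
  have := Cn (maxn n m); lra.
pose S := [set u m - 2 * C / 2 ^+ m | m in setT]; have hS : has_sup S.
  split; first by exists (u 0%N - 2 * C / 2 ^+ 0); exists 0%N.
  by exists (u 0%N + 2 * C / 2 ^+ 0) => _ [m _ <-]; exact: lohi.
have uS n : `|u n - sup S| <= 2 * C / 2 ^+ n.
  rewrite ler_norml; apply/andP; split.
    rewrite lerBrDr addrC lerBlDl addrC.
    by apply: ge_sup; [exact: hS.1|move=> _ [m _ <-]; exact: lohi].
  by rewrite lerBlDr -lerBlDl; apply: sup_upper_bound => //; exists n.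
suff -> : lim (u @ \oo) = sup S by [].
apply: cvg_lim => //; apply/cvgrPdist_le => e e0.
have /cvgrPdist_le/(_ e e0) := cvg_halving (2 * C).
apply: filterS => n; rewrite sub0r normrN ger0_norm// => h.
by rewrite distrC (le_trans (uS n)).
Qed.

(** Convergence is uniform on each [0, T], so that continuity passes to the
limit. *)
Lemma geometric_limit_continuous (y : nat -> R -> R) (Y : R -> R) :
  (forall n, {within `[0, +oo[, continuous (y n)}) ->
  (forall T, 0 <= T -> exists C, forall n t, 0 <= t -> t <= T ->
     `|y n t - Y t| <= C / 2 ^+ n) ->
  {within `[0, +oo[, continuous Y}.
Proof.
move=> yc yY; apply/subspace_continuousP => t /=; rewrite in_itv/= andbT => t0.
have [|C hC] := yY (t + 1); first by rewrite addr_ge0.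
apply/cvgrPdist_le => e e0.
have [n hn] : exists n, C / 2 ^+ n <= e / 3.
  apply: contrapT => /forallNP h; have : e / 3 <= 0.
    by apply: (@le0_geometric _ C) => n; apply/ltW; rewrite ltNge; exact/negP/h.
  by rewrite leNgt divr_gt0.
have /subspace_continuousP/(_ t) := yc n.
rewrite /= in_itv/= andbT => /(_ t0) /cvgrPdist_le /(_ (e / 3)).
rewrite divr_gt0// => /(_ isT); rewrite !near_withinE => near1.
have near2 : \forall s \near t, s <= t + 1.
  by exists 1 => //= s; rewrite /ball_/= ltr_distlC => /andP[_ /ltW].
near=> s; rewrite /= in_itv/= andbT => s0.
have h1 : `|y n t - y n s| <= e / 3.
  by have := near near1 s; apply => //; rewrite /= in_itv/= s0.
have h2 : `|y n s - Y s| <= e / 3.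
  by apply: le_trans hn; apply: hC => //; near: s.
have h3 : `|y n t - Y t| <= e / 3.
  by apply: le_trans hn; apply: hC => //; rewrite lerDl.
rewrite -[leLHS]/(`|Y t - Y s|); 
move: h1 h2 h3; rewrite !ler_norml => /andP[? ?] /andP[? ?] /andP[? ?].
by apply/andP; split; lra.
Unshelve. all: by end_near. Qed.

End GeometricConvergence.

(** * Linear lag equations *)

Section Lag.
Variable R : realType.
Implicit Types (f g : R -> R) (a b c l t : R).

(** The solution of f' = a (g - f), f 0 = c, by variation of constants. *)
Definition lag a c g t :=
  expR (- a * t) * (c + a * prim (fun s => expR (a * s) * g s) t).

Lemma lag_at0 a c g : lag a c g 0 = c.
Proof. by rewrite /lag mulr0 expR0 mul1r prim0 mulr0 addr0. Qed.

Lemma raydiff_lag a c g : {within `[0, +oo[, continuous g} ->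
  raydiff (lag a c g) (fun t => a * (g t - lag a c g t)).
Proof.
move=> gc; have egc : {within `[0, +oo[, continuous (fun s => expR (a * s) * g s)}.
  by have [ec _] := raydiff_expZ a; move=> x; exact: (cvgM (ec x) (gc x)).
have := raydiffM (raydiff_expZ (- a)) (raydiffD (raydiff_cst c)
  (raydiffZ a (raydiff_prim egc))).
move=> /raydiff_ext; apply => t _; rewrite /lag.
have := expRxMexpNx_1 (a * t); rewrite -mulNr => ee.
rewrite -[g t in RHS]mul1r -ee; ring.
Qed.

(** b exp (l t) is a supersolution of f' = a (g - f), because l >= 0. *)
Lemma lag_le_exp f g a b l t : raydiff f (fun s => a * (g s - f s)) ->
  0 <= a -> 0 <= b -> 0 <= l -> 0 <= t -> f 0 <= b ->
  (forall r, 0 < r -> r < t -> g r <= b * expR (l * r)) ->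
  f t <= b * expR (l * t).
Proof.
move=> fd a0 b0 l0 t0 fb gb.
have := raydiffB fd (raydiffZ b (raydiff_expZ l)).
move=> /(@raydiff_relax _ _ _ a 0 0 t) /(_ (lexx _) t0) h.
have {h}/h : forall r, 0 < r -> r < t -> a * (g r - f r) - b * (l * expR (l * r))
    <= - a * (f r - b * expR (l * r) - 0).
  move=> r r0 rt; have := ler_wpM2l a0 (gb r r0 rt).
  have : 0 <= b * (l * expR (l * r)) by rewrite !mulr_ge0 ?expR_ge0.
  by rewrite subr0 !mulrBr !mulNr; lra.
rewrite mulr0 expR0 mulr1 !subr0 add0r => h.
rewrite -subr_le0; apply: le_trans h _.
by rewrite mulr_le0_ge0 ?expR_ge0// subr_le0.
Qed.

Lemma lag_norm_le_exp f g a b l t : raydiff f (fun s => a * (g s - f s)) ->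
  0 <= a -> 0 <= b -> 0 <= l -> 0 <= t -> `|f 0| <= b ->
  (forall r, 0 < r -> r < t -> `|g r| <= b * expR (l * r)) ->
  `|f t| <= b * expR (l * t).
Proof.
move=> fd a0 b0 l0 t0 fb gb; rewrite ler_norml; apply/andP; split; last first.
  apply: (lag_le_exp fd) => //; first exact: le_trans (ler_norm _) fb.
  by move=> r r0 rt; exact: le_trans (ler_norm _) (gb r r0 rt).
rewrite lerNl; apply: (@lag_le_exp (fun s => - f s) (fun s => - g s) a) => //.
- by apply: raydiff_ext (raydiffN fd) _ => s _ /=; ring.
- by apply: le_trans fb; rewrite -normrN ler_norm.
- by move=> r r0 rt; apply: le_trans (gb r r0 rt); rewrite -normrN ler_norm.
Qed.

Lemma lag_ge0 f g a t : raydiff f (fun s => a * (g s - f s)) ->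
  0 <= a -> 0 <= t -> 0 <= f 0 -> (forall r, 0 < r -> 0 <= g r) -> 0 <= f t.
Proof.
move=> fd a0 t0 f0 g0; rewrite -oppr_le0 -(mul0r (expR (0 * t))).
apply: (@lag_le_exp (fun s => - f s) (fun s => - g s) a) => //.
- by apply: raydiff_ext (raydiffN fd) _ => s _ /=; ring.
- by rewrite oppr_le0.
- by move=> r r0 _; rewrite mul0r oppr_le0 g0.
Qed.

End Lag.

(** * Existence by a contraction on y *)

(** The factor 1 / l gained by integration is what makes the feedback map
contracting for large l. *)
Lemma raydiff_le_exp (R : realType) (f df : R -> R) a l t : raydiff f df ->
  0 < l -> 0 <= a -> 0 <= t -> f 0 <= 0 ->
  (forall r, 0 < r -> r < t -> df r <= a * expR (l * r)) ->
  f t <= a / l * expR (l * t).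
Proof.
move=> fd l0 a0 t0 f0 dfa.
have := raydiffB fd (raydiffZ (a / l) (raydiff_expZ l)).
move=> /raydiff_nincr /(_ (lexx _) t0) h.
rewrite -subr_le0; apply: le_trans (h _) _.
  move=> r r0 rt; rewrite mulrA divfK ?gt_eqF// subr_le0; exact: dfa.
rewrite mulr0 expR0 mulr1 subr_le0 (le_trans f0)// divr_ge0//; exact: ltW.
Qed.

Lemma expRN_lipschitz (R : realType) (p q : R) : 0 <= p -> 0 <= q ->
  `|expR (- p) - expR (- q)| <= `|p - q|.
Proof.
wlog pq : p q / p <= q => [hw p0 q0|p0 q0].
  have [pq|/ltW qp] := leP p q; first exact: hw.
  by rewrite distrC [leRHS]distrC; exact: hw.
rewrite [leRHS]distrC !ger0_norm ?subr_ge0 ?ler_expR ?lerN2//.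
have -> : expR (- q) = expR (- p) * expR (p - q).
  by rewrite -expRD; congr expR; ring.
have h1 : expR (- p) <= 1 by rewrite -expR0 ler_expR oppr_le0.
have h2 := expR_ge1Dx (p - q).
have h3 : expR (p - q) <= 1 by rewrite -expR0 ler_expR subr_le0.
rewrite -{1}[expR (- p)]mulr1 -mulrBr.
apply: (@le_trans _ _ (1 * (1 - expR (p - q)))); last lra.
by apply: ler_wpM2r => //; rewrite subr_ge0.
Qed.

Section Comparison.
Variable R : realType.
Implicit Types (y g : R -> R) (a b c l t : R).

Lemma prim_ge0 y t : {within `[0, +oo[, continuous y} ->
  (forall s, 0 <= s -> 0 <= y s) -> 0 <= t -> 0 <= prim y t.
Proof.
move=> yc yp t0; have := raydiff_nincr (raydiffN (raydiff_prim yc)) (lexx _) t0.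
rewrite prim0 oppr0 oppr_le0; apply => r r0 _.
by rewrite oppr_le0; apply/yp/ltW.
Qed.

Lemma prim_dist_le_exp y1 y2 a l t : {within `[0, +oo[, continuous y1} ->
  {within `[0, +oo[, continuous y2} -> 0 < l -> 0 <= a -> 0 <= t ->
  (forall s, 0 <= s -> s <= t -> `|y1 s - y2 s| <= a * expR (l * s)) ->
  `|prim y1 t - prim y2 t| <= a / l * expR (l * t).
Proof.
move=> c1 c2 l0 a0 t0 h.
rewrite ler_norml lerNl opprB; apply/andP; split.
  apply: (raydiff_le_exp (raydiffB (raydiff_prim c2) (raydiff_prim c1))) => //.
    by rewrite !prim0 subrr.
  move=> r r0 rt; apply: le_trans (h r (ltW r0) (ltW rt)).
  by rewrite distrC ler_norm.
apply: (raydiff_le_exp (raydiffB (raydiff_prim c1) (raydiff_prim c2))) => //.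
  by rewrite !prim0 subrr.
move=> r r0 rt; apply: le_trans (h r (ltW r0) (ltW rt)).
exact: ler_norm.
Qed.

Lemma lag_dist_le_exp g1 g2 a c b l t : {within `[0, +oo[, continuous g1} ->
  {within `[0, +oo[, continuous g2} -> 0 <= a -> 0 <= b -> 0 <= l -> 0 <= t ->
  (forall s, 0 <= s -> s <= t -> `|g1 s - g2 s| <= b * expR (l * s)) ->
  `|lag a c g1 t - lag a c g2 t| <= b * expR (l * t).
Proof.
move=> c1 c2 a0 b0 l0 t0 h.
have d : raydiff (fun s => lag a c g1 s - lag a c g2 s)
    (fun s => a * ((g1 s - g2 s) - (lag a c g1 s - lag a c g2 s))).
  by apply: raydiff_ext (raydiffB (raydiff_lag a c c1) (raydiff_lag a c c2)) _
    => s _ /=; ring.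
apply: (lag_norm_le_exp d) => //; first by rewrite !lag_at0 subrr normr0.
by move=> r r0 rt; exact: h (ltW r0) (ltW rt).
Qed.

End Comparison.

Section Existence.
Variables (R : realType) (k k3 k5 : R).
Hypotheses (hk3 : 0 < k3) (hk5 : 0 < k5).
Variables (x0 y0 z0 : R).
Hypotheses (hx0 : 0 <= x0) (hy0 : 0 <= y0) (hz0 : 0 <= z0).
Implicit Types (y : R -> R) (t T : R).

(** The solution of x' = k x - x y with x 0 = x0, for a given y. *)
Definition prey y t := x0 * expR (k * t - prim y t).

(** A fixed point of this map is the y-component of a solution: y determines
x, which determines z, which determines y. *)
Definition feedback y := lag k3 y0 (lag k5 z0 (prey y)).

Lemma raydiff_prey y : {within `[0, +oo[, continuous y} ->
  raydiff (prey y) (fun t => k * prey y t - prey y t * y t).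
Proof.
move=> yc.
have := raydiffZ x0 (raydiff_expR (raydiffB (raydiffZ k (@raydiff_id R)) (raydiff_prim yc))).
by move=> /raydiff_ext; apply => t _; rewrite /prey; ring.
Qed.

Lemma prey_ge0 y t : 0 <= prey y t.
Proof. by rewrite /prey mulr_ge0 ?expR_ge0. Qed.

Lemma prey_cont y : {within `[0, +oo[, continuous y} ->
  {within `[0, +oo[, continuous (prey y)}.
Proof. by move=> /raydiff_prey[]. Qed.

Lemma raydiff_lag_prey y : {within `[0, +oo[, continuous y} ->
  raydiff (lag k5 z0 (prey y)) (fun t => k5 * (prey y t - lag k5 z0 (prey y) t)).
Proof. by move=> yc; apply/raydiff_lag/prey_cont. Qed.

Lemma raydiff_feedback y : {within `[0, +oo[, continuous y} ->
  raydiff (feedback y) (fun t => k3 * (lag k5 z0 (prey y) t - feedback y t)).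
Proof. by move=> yc; apply/raydiff_lag; have [] := raydiff_lag_prey yc. Qed.

Lemma lag_prey_ge0 y t : {within `[0, +oo[, continuous y} -> 0 <= t ->
  0 <= lag k5 z0 (prey y) t.
Proof.
move=> yc t0; apply: (lag_ge0 (raydiff_lag_prey yc)) => //; first exact: ltW.
  by rewrite lag_at0.
by move=> r _; exact: prey_ge0.
Qed.

Lemma feedback_ge0 y t : {within `[0, +oo[, continuous y} -> 0 <= t ->
  0 <= feedback y t.
Proof.
move=> yc t0; apply: (lag_ge0 (raydiff_feedback yc)) => //; first exact: ltW.
  by rewrite /feedback lag_at0.
by move=> r r0; apply: lag_prey_ge0 => //; exact: ltW.
Qed.

(** On [0, T] the growth of x is bounded by a constant, and exp (- s) is
1-Lipschitz for s >= 0; hence the weight exp (l t) gains a factor c / l when y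
is integrated, and the two lags lose nothing. *)
Lemma feedback_contracting T : 0 <= T ->
  exists2 l, 0 < l & forall y1 y2 a, 0 <= a ->
    {within `[0, +oo[, continuous y1} -> {within `[0, +oo[, continuous y2} ->
    (forall t, 0 <= t -> 0 <= y1 t) -> (forall t, 0 <= t -> 0 <= y2 t) ->
    (forall t, 0 <= t -> t <= T -> `|y1 t - y2 t| <= a * expR (l * t)) ->
    forall t, 0 <= t -> t <= T ->
      `|feedback y1 t - feedback y2 t| <= a / 2 * expR (l * t).
Proof.
move=> T0; pose c := x0 * expR (`|k| * T); pose l := 2 * c + 1.
have c0 : 0 <= c by rewrite mulr_ge0 ?expR_ge0.
have l0 : 0 < l by rewrite /l; lra.
exists l => // y1 y2 a a0 c1 c2 p1 p2 h t t0 tT.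
have xd s : 0 <= s -> s <= t -> `|prey y1 s - prey y2 s| <= a / 2 * expR (l * s).
  move=> s0 st; have sT := le_trans st tT.
  rewrite /prey -mulrBr !expRD -mulrBr mulrA normrM.
  apply: (@le_trans _ _ (c * (a / l * expR (l * s)))).
    apply: ler_pM => //.
      rewrite ger0_norm ?mulr_ge0 ?expR_ge0// ler_wpM2l// ler_expR.
      apply: (le_trans (ler_norm _)); rewrite normrM ler_wpM2l//.
      by rewrite ger0_norm.
    apply: le_trans (expRN_lipschitz _ _) _; rewrite ?prim_ge0//.
    apply: prim_dist_le_exp => // r r0 rs.
    by apply: h => //; exact: le_trans sT.
  rewrite mulrA ler_wpM2r ?expR_ge0// mulrCA ler_wpM2l//.
  by rewrite ler_pdivrMr// /l; lra.
apply: lag_dist_le_exp => //; rewrite ?divr_ge0//; try exact: ltW.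
- by have [] := raydiff_lag_prey c1.
- by have [] := raydiff_lag_prey c2.
move=> s s0 st; apply: lag_dist_le_exp => //; rewrite ?divr_ge0//; try exact: ltW.
- exact: prey_cont.
- exact: prey_cont.
by move=> r r0 rs; apply: xd => //; exact: le_trans st.
Qed.

(** The iterates of 0 converge geometrically on every [0, T]; the rate 1 / 2
does not depend on T, but the weight and the constant do. *)
Lemma feedback_fixpoint : exists y, [/\ {within `[0, +oo[, continuous y},
  (forall t, 0 <= t -> 0 <= y t) & (forall t, 0 <= t -> feedback y t = y t)].
Proof.
pose u n := iter n feedback (fun=> 0).
have uc n : {within `[0, +oo[, continuous (u n)}.
  elim: n => [|n ih]; last by have [] := raydiff_feedback ih.
  by have [] := raydiff_cst (0 : R).
have up n t : 0 <= t -> 0 <= u n t.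
  by case: n => [//|n] t0; exact: feedback_ge0.
(* Only an upper bound of the three initial values is used. *)
pose b := x0 + y0 + z0.
have b0 : 0 <= b by rewrite !addr_ge0.
have u1 t : 0 <= t -> `|u 1%N t| <= b * expR (`|k| * t).
  move=> t0; rewrite ger0_norm ?up//.
  apply: (lag_le_exp (raydiff_feedback (uc 0%N))) => //; first exact: ltW.
    by rewrite /feedback lag_at0 /b; move: hx0 hy0 hz0; lra.
  move=> s s0 st.
  apply: (lag_le_exp (raydiff_lag_prey (uc 0%N))) => //; try exact: ltW.
    by rewrite lag_at0 /b; move: hx0 hy0 hz0; lra.
  move=> r r0 rs; rewrite /prey ler_pM ?expR_ge0//; first by rewrite /b; move: hx0 hy0 hz0; lra.
  rewrite ler_expR lerBlDr ler_wpDr ?(prim_ge0 (uc 0%N)) ?(ltW r0)//.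
  by rewrite ler_wpM2r ?(ltW r0)// ler_norm.
have geo T : 0 <= T -> exists C, forall n t, 0 <= t -> t <= T ->
    `|u n.+1 t - u n t| <= C / 2 ^+ n.
  move=> T0; have [l l0 hl] := feedback_contracting T0.
  pose a := b * expR (`|k| * T).
  have a0 : 0 <= a by rewrite mulr_ge0 ?expR_ge0.
  have w n t : 0 <= t -> t <= T -> `|u n.+1 t - u n t| <= a / 2 ^+ n * expR (l * t).
    elim: n t => [|n ih] t t0 tT.
      rewrite subr0 expr0 divr1; apply: le_trans (u1 t t0) _.
      rewrite /a -mulrA ler_wpM2l// -expRD ler_expR ler_wpDr//.
        by rewrite mulr_ge0// ltW.
      by rewrite ler_wpM2l.
    rewrite exprSr invfM mulrA; apply: (hl (u n.+1) (u n)) => //.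
    - by rewrite divr_ge0// exprn_ge0.
    - by move=> s; exact: up.
    - by move=> s; exact: up.
  exists (a * expR (l * T)) => n t t0 tT; apply: le_trans (w n t t0 tT) _.
  rewrite mulrAC ler_wpM2r ?invr_ge0 ?exprn_ge0// ler_wpM2l// ler_expR.
  by rewrite ler_wpM2l// ltW.
have [Y yY] : exists Y, forall T, 0 <= T -> exists C, forall n t, 0 <= t -> t <= T ->
    `|u n t - Y t| <= C / 2 ^+ n.
  eexists => T T0; have [C hC] := geo T T0; exists (2 * C) => n t t0 tT.
  by apply: (geometric_limit (u := u^~ t)) => m; exact: hC.
have Yc : {within `[0, +oo[, continuous Y} by exact: geometric_limit_continuous yY.
have Yp t : 0 <= t -> 0 <= Y t.
  move=> t0; have [C hC] := yY t t0.
  rewrite -oppr_le0; apply: (@le0_geometric _ _ C) => n.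
  have := hC n t t0 (lexx _); rewrite ler_norml => /andP[_].
  by have := up n t t0; lra.
exists Y; split => // t t0; apply/eqP; rewrite -subr_eq0 -normr_le0.
have [l l0 hl] := feedback_contracting t0.
have [C hC] := yY t t0.
apply: (@le0_geometric _ _ (C * expR (l * t) + C)) => n.
pose c := C / 2 ^+ n; pose w := c * expR (l * t).
have c0 : 0 <= c by exact: le_trans (normr_ge0 _) (hC n t t0 (lexx _)).
have w0 : 0 <= w by rewrite mulr_ge0 ?expR_ge0.
have h1 : `|feedback Y t - feedback (u n) t| <= w / 2.
  rewrite /w mulrAC; apply: hl => //; first by move=> s; exact: up.
  move=> s s0 st; rewrite distrC; apply: le_trans (hC n s s0 st) _.
  by rewrite ler_peMr// -expR0 ler_expR mulr_ge0// ltW.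
have h2 : `|u n.+1 t - Y t| <= c / 2.
  by rewrite /c -mulrA -invfM -exprSr; exact: hC.
have -> : (C * expR (l * t) + C) / 2 ^+ n = w + c by rewrite /w /c; ring.
have -> : feedback Y t - Y t = feedback Y t - feedback (u n) t + (u n.+1 t - Y t).
  by rewrite addrA subrK.
apply: le_trans (ler_normD _ _) (le_trans (lerD h1 h2) _).
clearbody c w; lra.
Qed.

End Existence.

(** * Well-posedness of the system *)

Lemma rV_norm_le (R : realType) n (v : 'rV[R]_n) (e : R) : 0 <= e ->
  (`|v| <= e) <-> (forall i, `|v 0 i| <= e).
Proof.
move=> e0; rewrite [leLHS]/Num.norm/= mx_normrE; split.
  by move=> /bigmax_leP[_ h] i; exact: (h (0, i)).
by move=> h; apply/bigmax_leP; split=> // -[i j] _; rewrite ord1.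
Qed.

Lemma within_continuous_rV (R : realType) n (A : set R) (u : R -> 'rV[R]_n) :
  (forall i, {within A, continuous (fun t => u t 0 i)}) -> {within A, continuous u}.
Proof.
move=> uc; apply/subspace_continuousP => t At; apply/cvgrPdist_le => e e0.
have : \forall s \near within A (nbhs t), forall i, `|u t 0 i - u s 0 i| <= e.
  apply: filter_forall => i; have /subspace_continuousP/(_ t At) := uc i.
  by move=> /cvgrPdist_le/(_ e e0).
apply: filterS => s h; apply/rV_norm_le; first exact: ltW.
by move=> i; rewrite !mxE; exact: h.
Qed.

Lemma within_continuous_coord (R : realType) n (A : set R) (u : R -> 'rV[R]_n) i :
  {within A, continuous u} -> {within A, continuous (fun t => u t 0 i)}.
Proof.
move=> /subspace_continuousP uc; apply/subspace_continuousP => x /uc ux.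
apply: (cvg_comp u (fun M : 'rV[R]_n => M 0 i) ux); exact: coord_continuous.
Qed.

Lemma forall_ord3 (P : 'I_3 -> Prop) : P 0 -> P 1 -> P 2 -> forall i, P i.
Proof.
move=> P0 P1 P2 [[|[|[|//]]] hi].
- by rewrite (_ : Ordinal hi = 0)//; exact: val_inj.
- by rewrite (_ : Ordinal hi = 1)//; exact: val_inj.
- by rewrite (_ : Ordinal hi = 2)//; exact: val_inj.
Qed.

(** The key is x y - x' y' = (x - x') y + x' (y - y'): the first part
contributes the favourable term - 2 y (x - x')^2, so that a bound on x' alone
suffices.  The difference of the two sides is an explicit sum of nonnegative
terms. *)
Lemma energy_growth (F : realFieldType) (k k3 k5 K X x y z x' y' z' : F) :
  0 <= k3 -> 0 <= k5 -> k <= K -> 0 <= K -> 0 <= y -> 0 <= x' -> x' <= X ->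
  2 * (k * x - x * y - (k * x' - x' * y')) * (x - x')
    + 2 * (k3 * (z - y) - k3 * (z' - y')) * (y - y')
    + 2 * (k5 * (x - z) - k5 * (x' - z')) * (z - z')
  <= (2 * K + X + k3 + k5) * ((x - x') ^+ 2 + (y - y') ^+ 2 + (z - z') ^+ 2).
Proof.
move=> k30 k50 kK K0 y0 x'0 x'X; rewrite -subr_ge0.
pose a := x - x'; pose b := y - y'; pose c := z - z'; rewrite -/a -/b -/c.
have -> : (2 * K + X + k3 + k5) * (a ^+ 2 + b ^+ 2 + c ^+ 2)
    - (2 * (k * x - x * y - (k * x' - x' * y')) * a
      + 2 * (k3 * (z - y) - k3 * (z' - y')) * b
      + 2 * (k5 * (x - z) - k5 * (x' - z')) * c)
  = 2 * (K - k) * a ^+ 2 + 2 * K * (b ^+ 2 + c ^+ 2) + 2 * y * a ^+ 2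
    + ((X - x') * (a ^+ 2 + b ^+ 2) + x' * (a + b) ^+ 2 + X * c ^+ 2)
    + k3 * (a ^+ 2 + 2 * b ^+ 2 + (b - c) ^+ 2)
    + k5 * (b ^+ 2 + 2 * c ^+ 2 + (a - c) ^+ 2).
  by rewrite /a /b /c; ring.
have X0 := le_trans x'0 x'X.
by do ?[done | exact: sqr_ge0 | rewrite subr_ge0 | apply: addr_ge0 | apply: mulr_ge0].
Qed.

Section Solutions.
Variables (R : realType) (k k3 k5 : R).
Hypotheses (hk3 : 0 < k3) (hk5 : 0 < k5).
Implicit Types (p q : 'rV[R]_3) (u v : R -> 'rV[R]_3) (b s t : R).

Local Notation solution := (solution k k3 k5).
Local Notation flow := (flow k k3 k5).

Section Coordinates.
Variables (p : 'rV[R]_3) (u : R -> 'rV[R]_3).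
Hypothesis up : solution p u.

Lemma solution_at0 : u 0 = p. Proof. by case: up. Qed.

Lemma solution_ge0 t i : 0 <= t -> 0 <= u t 0 i.
Proof. by case: up => _ h _ _ t0; exact: h. Qed.

Lemma solution_x :
  raydiff (fun t => u t 0 0) (fun t => k * u t 0 0 - u t 0 0 * u t 0 1).
Proof.
by case: up => _ _ c d; split; [exact: within_continuous_coord|move=> t /d[]].
Qed.

Lemma solution_y : raydiff (fun t => u t 0 1) (fun t => k3 * (u t 0 2 - u t 0 1)).
Proof.
by case: up => _ _ c d; split; [exact: within_continuous_coord|move=> t /d[]].
Qed.

Lemma solution_z : raydiff (fun t => u t 0 2) (fun t => k5 * (u t 0 0 - u t 0 2)).
Proof.
by case: up => _ _ c d; split; [exact: within_continuous_coord|move=> t /d[]].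
Qed.

Lemma solution_x_le_exp K t : k <= K -> 0 <= t -> u t 0 0 <= p 0 0 * expR (K * t).
Proof.
move=> kK t0; have := @raydiff_relax _ _ _ (- K) 0 0 t solution_x (lexx _) t0.
rewrite solution_at0 !subr0 add0r opprK; apply => r r0 _.
have x0 := solution_ge0 0 (ltW r0); have y0 := solution_ge0 1 (ltW r0).
by rewrite subr0 -[leRHS]subr0 lerB ?mulr_ge0// ler_wpM2r.
Qed.

Lemma solution_le_exp K b t i : k <= K -> 0 <= K -> (forall j, p 0 j <= b) ->
  0 <= t -> u t 0 i <= b * expR (K * t).
Proof.
move=> kK K0 pb t0.
have b0 : 0 <= b.
  by apply: le_trans (pb 0); rewrite -solution_at0; exact: solution_ge0.
have x r : 0 <= r -> u r 0 0 <= b * expR (K * r).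
  move=> r0; apply: (le_trans (solution_x_le_exp kK r0)).
  by rewrite ler_wpM2r ?expR_ge0.
have z r : 0 <= r -> u r 0 2 <= b * expR (K * r).
  move=> r0; apply: (lag_le_exp solution_z) => //; first exact: ltW.
    by rewrite solution_at0.
  by move=> q q0 _; apply/x/ltW.
move: i; apply: forall_ord3; [exact: x| |exact: z].
apply: (lag_le_exp solution_y) => //; first exact: ltW.
  by rewrite solution_at0.
by move=> q q0 _; apply/z/ltW.
Qed.

Lemma solution_shift s : 0 <= s -> solution (u s) (fun t => u (t + s)).
Proof.
move=> s0; case: (up) => _ u0 uc ud; split.
- by rewrite add0r.
- by move=> t t0; apply: u0; rewrite addr_ge0.
- apply/subspace_continuousP => t; rewrite /= in_itv/= andbT => t0.
  have /subspace_continuousP/(_ (t + s)) := uc.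
  rewrite /= in_itv/= andbT => /(_ (addr_ge0 t0 s0)).
  apply: (@cvg_comp _ _ _ (fun r => r + s)) => A [e /= e0 eA].
  exists e => // r /= tr; rewrite in_itv/= andbT => r0.
  apply: eA; last by rewrite /= in_itv/= andbT addr_ge0.
  by move: tr; rewrite /ball_/= opprD addrACA subrr addr0.
- move=> t t0; have [dx dy dz] := ud (t + s) (ltr_wpDr s0 t0).
  have dshift (f : R -> R) (d : R) :
      is_derive (t + s) 1 f d -> is_derive t 1 (fun r => f (r + s)) d.
    move=> fd; rewrite -[d]mulr1.
    exact: (@is_derive1_comp _ f (shift s) t _ _ _ (is_derive_shift t 1 s)).
  by split; exact: dshift.
Qed.

End Coordinates.

Definition sqdist p q := \sum_i (p 0 i - q 0 i) ^+ 2.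

Lemma sqdistE p q : sqdist p q =
  (p 0 0 - q 0 0) ^+ 2 + (p 0 1 - q 0 1) ^+ 2 + (p 0 2 - q 0 2) ^+ 2.
Proof.
rewrite /sqdist !big_ord_recl big_ord0 addr0 addrA.
by do ![congr (_ + _)]; congr ((_ - _) ^+ _); congr (_ 0 _); exact: val_inj.
Qed.

Lemma sqdist_ge0 p q : 0 <= sqdist p q.
Proof. by apply: sumr_ge0 => i _; exact: sqr_ge0. Qed.

Lemma sq_coord_le_sqdist p q i : (p 0 i - q 0 i) ^+ 2 <= sqdist p q.
Proof.
by rewrite /sqdist (bigD1 i)//= lerDl sumr_ge0// => j _; exact: sqr_ge0.
Qed.

Lemma sqdist_le_norm p q : sqdist p q <= 3 * `|p - q| ^+ 2.
Proof.
have h i : (p 0 i - q 0 i) ^+ 2 <= `|p - q| ^+ 2.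
  rewrite -real_normK ?num_real// ler_sqr ?nnegrE//.
  have /rV_norm_le/(_ i) : `|p - q| <= `|p - q| by [].
  by rewrite !mxE; apply.
by rewrite sqdistE; move: (h 0) (h 1) (h 2); lra.
Qed.

(** One-sided in the data: only the second solution is bounded, so that this
yields uniqueness, and continuity of the flow at q with no bound on nearby
points. *)
Lemma solution_sqdist T b : 0 <= T -> exists2 C, 0 < C &
  forall p q u v, solution p u -> solution q v -> q 0 0 <= b ->
  forall t, 0 <= t -> t <= T -> sqdist (u t) (v t) <= C * sqdist p q.
Proof.
move=> T0; pose X := Num.max 0 b * expR (`|k| * T).
have X0 : 0 <= X by rewrite mulr_ge0 ?expR_ge0// le_max lexx.
pose L := 2 * `|k| + X + k3 + k5.
have L0 : 0 <= L.
  by rewrite /L !addr_ge0 ?(ltW hk3) ?(ltW hk5)// mulr_ge0.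
exists (expR (L * T)) => [|p q u v up vq qb t t0 tT]; first exact: expR_gt0.
have dx := raydiffB (solution_x up) (solution_x vq).
have dy := raydiffB (solution_y up) (solution_y vq).
have dz := raydiffB (solution_z up) (solution_z vq).
have := raydiffD (raydiffD (raydiffM dx dx) (raydiffM dy dy)) (raydiffM dz dz).
move=> /(@raydiff_relax _ _ _ (- L) 0 0 t) /(_ (lexx _) t0) h.
rewrite mulrC sqdistE; apply: (@le_trans _ _ (sqdist (u 0) (v 0) * expR (L * t))).
  rewrite sqdistE !expr2; move: h; rewrite !add0r !subr0 opprK; apply => r r0 rt.
  have x0 := solution_ge0 up 0 (ltW r0); have y0 := solution_ge0 up 1 (ltW r0).
  have w0 := solution_ge0 vq 0 (ltW r0).
  have wX : v r 0 0 <= X.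
    apply: (le_trans (solution_x_le_exp vq (ler_norm k) (ltW r0))).
    apply: ler_pM; rewrite ?expR_ge0//.
    - by rewrite -(solution_at0 vq); exact: (solution_ge0 vq).
    - by rewrite le_max qb orbT.
    - by rewrite ler_expR ler_wpM2l// (le_trans (ltW rt)).
  have kk := ler_norm k.
  have growth := energy_growth (u r 0 0) (u r 0 2) (v r 0 1) (v r 0 2) (ltW hk3) (ltW hk5)
    kk (normr_ge0 k) y0 w0 wX.
  rewrite subr0 /L -!expr2; apply: le_trans growth.
  by rewrite le_eqVlt; apply/orP; left; apply/eqP; ring.
rewrite (solution_at0 up) (solution_at0 vq) ler_wpM2l ?sqdist_ge0// ler_expR.
by rewrite ler_wpM2l.
Qed.

Lemma solution_unique p u v t : solution p u -> solution p v -> 0 <= t -> u t = v t.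
Proof.
move=> up vp t0; have [C C0 h] := solution_sqdist (p 0 0) t0.
have := h p p u v up vp (lexx _) t t0 (lexx _).
have -> : sqdist p p = 0 by rewrite sqdistE !subrr expr0n/= !addr0.
rewrite mulr0 => d0; apply/rowP => i; apply/eqP; rewrite -subr_eq0 -sqrf_eq0.
by rewrite eq_le sqr_ge0 andbT; exact: le_trans (sq_coord_le_sqdist _ _ _) d0.
Qed.

Lemma solution_exists p : orthant p -> exists u, solution p u.
Proof.
move=> p0.
have [y [yc y0 yE]] := feedback_fixpoint k hk3 hk5 (p0 0) (p0 1) (p0 2).
pose x := prey k (p 0 0) y; pose z := lag k5 (p 0 2) x.
pose w := feedback k k3 k5 (p 0 0) (p 0 1) (p 0 2) y.
pose u t : 'rV[R]_3 := \row_i [:: x t; w t; z t]`_i.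
have xd := raydiff_prey k (p 0 0) yc.
have zd := raydiff_lag_prey k k5 (p 0 0) (p 0 2) yc.
have wd := raydiff_feedback k k3 k5 (p 0 0) (p 0 1) (p 0 2) yc.
have u0E : (fun t => u t 0 0) = x by apply/funext => t; rewrite !mxE.
have u1E : (fun t => u t 0 1) = w by apply/funext => t; rewrite !mxE.
have u2E : (fun t => u t 0 2) = z by apply/funext => t; rewrite !mxE.
exists u; split.
- apply/rowP; apply: forall_ord3; rewrite mxE /=.
  + by rewrite /x /prey mulr0 prim0 subrr expR0 mulr1.
  + by rewrite /w /feedback lag_at0.
  + by rewrite /z lag_at0.
- move=> t t0; apply: forall_ord3; rewrite mxE /=.
  + exact: prey_ge0.
  + exact: feedback_ge0.
  + exact: lag_prey_ge0.
- apply: within_continuous_rV; apply: forall_ord3.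
  + by rewrite u0E; case: xd.
  + by rewrite u1E; case: wd.
  + by rewrite u2E; case: zd.
- move=> t t0; rewrite u0E u1E u2E; split.
  + by rewrite !mxE/= /w yE ?(ltW t0)//; exact: xd.2.
  + by rewrite !mxE/=; exact: wd.2.
  + by rewrite !mxE/=; exact: zd.2.
Qed.

Lemma flow_solution p : orthant p -> solution p (flow^~ p).
Proof.
move=> /solution_exists[u up].
exact: (@xgetPex _ (fun=> p) [set u | solution p u] (ex_intro _ u up)).
Qed.

Lemma flowE p u t : orthant p -> solution p u -> 0 <= t -> flow t p = u t.
Proof. by move=> /flow_solution; exact: solution_unique. Qed.

Lemma flow_orthant p t : orthant p -> 0 <= t -> orthant (flow t p).
Proof. by move=> /flow_solution[_ + _ _]; exact. Qed.

Lemma flow0 p : orthant p -> flow 0 p = p.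
Proof. by move=> /flow_solution[]. Qed.

Lemma flowD p s t : orthant p -> 0 <= s -> 0 <= t ->
  flow (t + s) p = flow t (flow s p).
Proof.
move=> p0 s0 t0; have ps := flow_orthant p0 s0.
by rewrite (flowE ps (solution_shift (flow_solution p0) s0)).
Qed.

Lemma flow_continuous t : 0 <= t -> {within @orthant R, continuous (flow t)}.
Proof.
move=> t0; apply/subspace_continuousP => q q0; apply/cvgrPdist_le => e e0.
have [C C0 h] := solution_sqdist (q 0 0) t0.
have d0 : 0 < e / Num.sqrt (3 * C) by rewrite divr_gt0// sqrtr_gt0 mulr_gt0.
rewrite near_withinE; apply/nbhs_ballP; exists (e / Num.sqrt (3 * C)) => //= p qp p0.
rewrite distrC; apply/rV_norm_le; first exact: ltW.
move=> i; rewrite !mxE -ler_sqr ?nnegrE ?(ltW e0)// real_normK ?num_real//.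
apply: (le_trans (sq_coord_le_sqdist _ _ _)).
apply: (le_trans (h _ _ _ _ (flow_solution p0) (flow_solution q0) (lexx _) t t0 (lexx _))).
have qpe : `|p - q| ^+ 2 <= (e / Num.sqrt (3 * C)) ^+ 2.
  rewrite ler_sqr ?nnegrE ?(ltW d0)// distrC; apply: ltW.
  by move: qp; rewrite mx_norm_ball.
apply: (@le_trans _ _ (C * (3 * (e / Num.sqrt (3 * C)) ^+ 2))).
  rewrite ler_pM2l//; apply: (le_trans (sqdist_le_norm _ _)); rewrite ler_pM2l//.
rewrite expr_div_n sqr_sqrtr; last by rewrite mulr_ge0 ?(ltW C0).
by rewrite mulrA [C * 3]mulrC mulrCA divff ?mulr1// mulf_neq0// gt_eqF.
Qed.

End Solutions.

(** * Attractor of a semigroup with a compact absorbing set *)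

Lemma nested_compact_nonempty (R : realType) (T : topologicalType) (F : R -> set T) :
  hausdorff_space T -> (forall t, 0 <= t -> compact (F t)) ->
  (forall s t, 0 <= s -> s <= t -> F t `<=` F s) ->
  (forall t, 0 <= t -> F t !=set0) -> exists p, forall t, 0 <= t -> F t p.
Proof.
move=> hT Fc Fd F0; pose G := filter_from [set t : R | 0 <= t] F.
have GF : ProperFilter G.
  apply: filter_from_proper; last by move=> t; exact: F0.
  apply: filter_from_filter; first by exists 0 => /=.
  move=> s t /= s0 t0; exists (Num.max s t) => /=; first by rewrite le_max s0.
  by move=> p Fp; split; move: p Fp; apply: Fd => //; rewrite le_max lexx ?orbT.
have [|p [_ Gp]] := Fc 0 (lexx _) G GF; first by exists 0 => /=.
exists p => t t0; apply: (compact_closed hT (Fc t t0)).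
by move: Gp; rewrite clusterE; apply; exists t.
Qed.

(** The semigroup is continuous only on the phase space X, hence the
intersection with a compact subset of X. *)
Lemma compact_setI_preimage (T : topologicalType) (X C D : set T) (f : T -> T) :
  hausdorff_space T -> compact C -> C `<=` X -> closed D ->
  {within X, continuous f} -> compact (C `&` f @^-1` D).
Proof.
move=> hT Cc CX Dc /subspace_continuousP fc.
apply: (subclosed_compact _ Cc) => [p clp|]; last by move=> p [].
have Cp : C p.
  by apply: (compact_closed hT Cc); apply: closure_subset clp => q [].
split=> //=; apply: Dc => B fB.
have /clp[q [[Cq Dq]]] := fc p (CX p Cp) B fB.
by move=> /(_ (CX q Cq)) Bq; exists (f q).
Qed.

Section AbsorbingSet.
Variables (R : realType) (T : pseudoMetricType R) (X K : set T) (phi : R -> T -> T).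
Variable bounded : set T -> Prop.
Hypothesis hT : hausdorff_space T.
Hypothesis phiX : forall p t, X p -> 0 <= t -> X (phi t p).
Hypothesis phi0 : forall p, X p -> phi 0 p = p.
Hypothesis phiD : forall p s t, X p -> 0 <= s -> 0 <= t ->
  phi (t + s) p = phi t (phi s p).
Hypothesis phiC : forall t, 0 <= t -> {within X, continuous (phi t)}.
Hypotheses (Kc : compact K) (K0 : K !=set0) (KX : K `<=` X) (Kb : bounded K).
Hypothesis absorbing : forall B, B `<=` X -> bounded B ->
  exists2 s, 0 <= s & forall t p, s <= t -> B p -> K (phi t p).

(** Unlike K, this set is mapped into itself, so its images decrease. *)
Let N := [set p | X p /\ forall t, 0 <= t -> K (phi t p)].

Let NK : N `<=` K.
Proof. by move=> p [Xp /(_ 0 (lexx _))]; rewrite phi0. Qed.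

Let NX : N `<=` X.
Proof. by move=> p []. Qed.

Let N_compact : compact N.
Proof.
have -> : N = \bigcap_(t in [set t | 0 <= t]) (K `&` phi t @^-1` K).
  apply/seteqP; split=> p Np; first by move=> t t0; split; [exact: NK|exact: Np.2].
  by split=> [|t t0]; [apply: KX; exact: (Np 0 (lexx _)).1|exact: (Np t t0).2].
apply: (subclosed_compact _ Kc) => [|p Np]; last exact: (Np 0 (lexx _)).1.
apply: closed_bigI => t t0; apply: (compact_closed hT).
by apply: compact_setI_preimage (phiC t0) => //; exact: compact_closed.
Qed.

Let phiN p t : N p -> 0 <= t -> N (phi t p).
Proof.
move=> [Xp Kp] t0; split; first exact: phiX.
by move=> s s0; rewrite -phiD//; apply: Kp; rewrite addr_ge0.
Qed.

Let orbit_enters_N B : B `<=` X -> bounded B ->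
  exists2 s, 0 <= s & forall p, B p -> N (phi s p).
Proof.
move=> BX Bb; have [s s0 h] := absorbing BX Bb.
exists s => // p Bp; split; first by apply: phiX => //; exact: BX.
by move=> t t0; rewrite -phiD//; [apply: h => //; rewrite lerDr|exact: BX].
Qed.

Let image_compact t : 0 <= t -> compact (phi t @` N).
Proof.
move=> t0; apply: continuous_compact => //.
exact: continuous_subspaceW NX (phiC t0).
Qed.

Let image_decr s t : 0 <= s -> s <= t -> phi t @` N `<=` phi s @` N.
Proof.
move=> s0 st _ [p Np <-]; have ts0 : 0 <= t - s by rewrite subr_ge0.
exists (phi (t - s) p); first exact: phiN.
by rewrite -phiD ?subrKC//; exact: NX.
Qed.

Let A := [set p | forall t, 0 <= t -> (phi t @` N) p].

Let AN : A `<=` N.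
Proof. by move=> p /(_ 0 (lexx _))[q Nq <-]; apply: phiN. Qed.

(** For the backward inclusion, the preimages of p under phi t in the sets
phi s (N) are nested nonempty compact sets, and a common point belongs to
A. *)
Let A_invariant t : 0 <= t -> phi t @` A = A.
Proof.
move=> t0; apply/seteqP; split=> [_ [p Ap <-] s s0|p Ap].
  have [st|/ltW ts] := leP s t; last first.
    have [q Nq <-] := Ap (s - t) ltac:(by rewrite subr_ge0).
    exists q => //; rewrite -phiD ?subrKC ?subr_ge0//; exact: NX.
  by apply: (image_decr s0 st); exists p => //; exact: AN.
pose F s := phi s @` N `&` phi t @^-1` [set p].
have [| | |q Fq] := @nested_compact_nonempty R T F hT.
- move=> s s0; apply: compact_setI_preimage (phiC t0) => //.
  + exact: image_compact.
  + by move=> _ [r Nr <-]; apply: phiX => //; exact: NX.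
  + by apply: (compact_closed hT); exact: compact_set1.
- by move=> r s r0 rs q [qs qp]; split=> //; exact: image_decr qs.
- move=> s s0; have [q Nq qp] := Ap (t + s) (addr_ge0 t0 s0).
  exists (phi s q); split; first by exists q.
  by rewrite /= -phiD//; exact: NX.
exists q; last exact: (Fq 0 (lexx _)).2.
by move=> s s0; exact: (Fq s s0).1.
Qed.

(** Otherwise the parts of the images of N outside a neighbourhood of A would
have a common point, which would be in A. *)
Let A_attracts e : 0 < e ->
  exists2 s, 0 <= s & forall t q, s <= t -> N q -> exists2 a, A a & ball a e (phi t q).
Proof.
move=> e0; pose U := \bigcup_(a in A) (ball a e)°.
have Uo : open U by apply: bigcup_open => a _; exact: open_interior.
suff [s s0 sU] : exists2 s, 0 <= s & phi s @` N `<=` U.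
  exists s => // t q st Nq.
  have /sU[a Aa ha] : (phi s @` N) (phi t q) by apply: (image_decr s0 st); exists q.
  by exists a => //; exact: interior_subset ha.
apply: contrapT => noU.
have [| | |p Fp] := @nested_compact_nonempty R T (fun t => phi t @` N `&` ~` U) hT.
- move=> t t0; apply: compact_closedI; first exact: image_compact.
  exact: open_closedC.
- by move=> r s r0 rs q [qs qp]; split=> //; exact: image_decr qs.
- move=> t t0; apply: contrapT => F0; apply: noU; exists t => // q qN.
  by apply: contrapT => nUq; apply: F0; exists q.
apply: (Fp 0 (lexx _)).2; exists p; first by move=> t t0; exact: (Fp t t0).1.
exact: nbhsx_ballx.
Qed.

(** The third property, inclusion of the attractor in the images of K at all
times, transfers asymptotic bounds on K to the attractor. *)
Lemma attractor_of_absorbing : exists A : set T,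
  [/\ A !=set0, compact A, forall t, 0 <= t -> A `<=` phi t @` K,
      forall t, 0 <= t -> phi t @` A = A &
      forall B, B `<=` X -> bounded B -> forall e, 0 < e ->
        exists2 s, 0 <= s & forall t p, s <= t -> B p ->
          exists2 a, A a & ball a e (phi t p)].
Proof.
exists A; split.
- have [s s0 hs] := orbit_enters_N KX Kb; have [p Kp] := K0.
  have [| | |q Fq] := @nested_compact_nonempty R T (fun t => phi t @` N) hT.
  + exact: image_compact.
  + exact: image_decr.
  + by move=> t t0; exists (phi t (phi s p)); exists (phi s p) => //; exact: hs.
  by exists q.
- have -> : A = \bigcap_(t in [set t | 0 <= t]) (phi t @` N) by [].
  apply: (subclosed_compact _ N_compact); last exact: AN.
  by apply: closed_bigI => t t0; apply: (compact_closed hT); exact: image_compact.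
- by move=> t t0 p /(_ t t0)[q /NK Kq <-]; exists q.
- exact: A_invariant.
- move=> B BX Bb e e0; have [s s0 hs] := orbit_enters_N BX Bb.
  have [r r0 hr] := A_attracts e0.
  exists (r + s) => [|t p rst Bp]; first by rewrite addr_ge0.
  have -> : phi t p = phi (t - s) (phi s p).
    by rewrite -phiD ?subrK//; [exact: BX|rewrite subr_ge0 (le_trans _ rst)// lerDr].
  by apply: hr; [rewrite lerBrDr|exact: hs].
Qed.

End AbsorbingSet.

(** * Uniform asymptotic bounds *)

Section Dissipativity.
Variables (R : realType) (k k3 k5 : R).
Hypotheses (hk3 : 0 < k3) (hk5 : 0 < k5).
Implicit Types (p : 'rV[R]_3) (u : R -> 'rV[R]_3) (f g : 'rV[R]_3 -> R).

Local Notation solution := (solution k k3 k5).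
Local Notation flow := (flow k k3 k5).

(** An asymptotic upper bound c for f along solutions, uniform over the
initial points whose coordinates are at most b. *)
Definition eventually_le b f c := forall e, 0 < e -> exists2 T, 0 <= T &
  forall p u, solution p u -> (forall i, p 0 i <= b) ->
  forall t, T <= t -> f (u t) <= c + e.

(** A quantity f that relaxes at rate a towards g inherits the asymptotic
bound of g. *)
Lemma eventually_le_relax a b c f g : 0 < a ->
  (forall p u, solution p u -> exists2 df, raydiff (f \o u) df &
     forall t, 0 < t -> df t <= a * (g (u t) - f (u t))) ->
  (forall T, 0 <= T -> exists C, forall p u, solution p u ->
     (forall i, p 0 i <= b) -> f (u T) <= C) ->
  eventually_le b g c -> eventually_le b f c.
Proof.
move=> a0 fd fC gc e e0.
have [T T0 gT] := gc (e / 2) (divr_gt0 e0 (ltr0Sn _ 1)).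
have [C hC] := fC T T0.
pose d := Num.max 0 (C - (c + e / 2)).
have d0 : 0 <= d by rewrite le_max lexx.
have t0 : 0 <= 2 * d / (e * a) by rewrite divr_ge0 ?mulr_ge0// ltW.
(* This waiting time is enough because exp (- s) <= 1 / (1 + s). *)
exists (T + 2 * d / (e * a)) => [|p u up pb t Tt]; first by rewrite addr_ge0.
have Tt' : T <= t by apply: le_trans Tt; rewrite lerDl.
have [df fdf dfle] := fd p u up.
have := @raydiff_relax _ _ _ a (c + e / 2) T t fdf T0 Tt' => h.
have {h}/h/le_trans : forall r, T < r -> r < t -> df r <= - a * ((f \o u) r - (c + e / 2)).
  move=> r Tr rt; apply: le_trans (dfle r (le_lt_trans T0 Tr)) _.
  rewrite mulNr -mulrN ler_wpM2l ?(ltW a0)//= opprB lerB//.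
  exact: gT up pb _ (ltW Tr).
apply; rewrite (_ : c + e = c + e / 2 + e / 2); last by field.
rewrite lerD2l /=.
pose s := a * (t - T).
have s1 : 2 * d / e <= s.
  have : 2 * d / (e * a) <= t - T by rewrite lerBrDl.
  move=> /(ler_wpM2l (ltW a0)); rewrite (_ : a * (2 * d / (e * a)) = 2 * d / e)//.
  by field; rewrite !lt0r_neq0.
have s0 : 0 < 1 + s.
  apply: lt_le_trans (_ : 1 + 2 * d / e <= _); rewrite ?lerD2l//.
  by rewrite ltr_pwDl// divr_ge0 ?mulr_ge0// ltW.
apply: (@le_trans _ _ (d * expR (- a * (t - T)))).
  rewrite ler_wpM2r ?expR_ge0// le_max; apply/orP; right.
  by rewrite lerD2r; exact: hC up pb.
rewrite mulNr -/s expRN ler_pdivrMr ?expR_gt0//.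
apply: (@le_trans _ _ (e / 2 * (1 + s))); last first.
  by rewrite ler_wpM2l ?expR_ge1Dx// divr_ge0// ltW.
have : e / 2 * (2 * d / e) <= e / 2 * s by rewrite ler_wpM2l// divr_ge0// ltW.
rewrite (_ : e / 2 * (2 * d / e) = d); last by field; exact: lt0r_neq0.
by rewrite mulrDr mulr1; move=> ?; apply: ler_wpDl => //; rewrite divr_ge0// ltW.
Qed.

Definition growth_rate := Num.max k 0.

(** With K the growth rate, this is z / x for the solution of z' = k5 (x - z)
proportional to x = exp (K t); yx_ratio is y / x for the corresponding
solution of y' = k3 (z - y). *)
Definition zx_ratio := k5 / (growth_rate + k5).
Definition yx_ratio := zx_ratio * k3 / (growth_rate + k3).
Definition attractor_bound := growth_rate / yx_ratio.

Local Notation K := growth_rate.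
Local Notation al := zx_ratio.
Local Notation c := yx_ratio.

Let kK : k <= K. Proof. by rewrite /growth_rate le_max lexx. Qed.
Let K0 : 0 <= K. Proof. by rewrite /growth_rate le_max lexx orbT. Qed.
Let Kk5 : 0 < K + k5. Proof. by rewrite ltr_wpDl. Qed.
Let Kk3 : 0 < K + k3. Proof. by rewrite ltr_wpDl. Qed.
Let al0 : 0 < al. Proof. by rewrite divr_gt0. Qed.
Let c0 : 0 < c. Proof. by rewrite divr_gt0// mulr_gt0. Qed.
Let alE : al * (K + k5) = k5. Proof. by rewrite /zx_ratio divfK// gt_eqF. Qed.
Let cE : c * (K + k3) = al * k3. Proof. by rewrite /yx_ratio divfK// gt_eqF. Qed.

(** The derivative of al x - z is at most - k5 (al x - z), as
al (k + k5) <= k5 and the term - al x y is nonpositive. *)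
Lemma eventually_z_ge b : eventually_le b (fun p => al * p 0 0 - p 0 2) 0.
Proof.
apply: (@eventually_le_relax k5 _ _ _ (fun=> 0)) => //.
- move=> p u up; eexists.
    exact: raydiffB (raydiffZ al (solution_x up)) (solution_z up).
  move=> t /ltW t0 /=.
  have x0 := solution_ge0 up 0 t0; have y0 := solution_ge0 up 1 t0.
  have h1 : k * u t 0 0 <= K * u t 0 0 by rewrite ler_wpM2r.
  have h2 := mulr_ge0 (ltW al0) (mulr_ge0 x0 y0).
  have h3 : al * (k * u t 0 0) <= al * (K * u t 0 0) by rewrite ler_wpM2l// ltW.
  have h4 : al * (K * u t 0 0) = k5 * u t 0 0 - k5 * (al * u t 0 0).
    by rewrite -{1}alE; ring.
  rewrite sub0r mulrBr -subr_ge0.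
  rewrite (_ : _ - _ = k5 * u t 0 0 - k5 * (al * u t 0 0) - al * (k * u t 0 0)
     + al * (u t 0 0 * u t 0 1)); last by ring.
  by rewrite addr_ge0// -h4 subr_ge0.
- move=> T T0; exists (al * (b * expR (K * T))) => p u up pb.
  apply: (@le_trans _ _ (al * u T 0 0)); first by rewrite lerBlDr lerDl (solution_ge0 up).
  rewrite ler_wpM2l ?(ltW al0)//.
  exact: (solution_le_exp hk3 hk5 up _ kK K0 pb T0).
- by move=> e e0; exists 0 => // *; rewrite add0r ltW.
Qed.

(** The same cancellation shows that c x - y relaxes at rate k3 towards
al x - z, or to something smaller. *)
Lemma eventually_y_ge b : eventually_le b (fun p => c * p 0 0 - p 0 1) 0.
Proof.
apply: (eventually_le_relax hk3 _ _ (@eventually_z_ge b)).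
- move=> p u up; eexists.
    exact: raydiffB (raydiffZ c (solution_x up)) (solution_y up).
  move=> t /ltW t0 /=.
  have x0 := solution_ge0 up 0 t0; have y0 := solution_ge0 up 1 t0.
  have h2 := mulr_ge0 (ltW c0) (mulr_ge0 x0 y0).
  have h3 : c * (k * u t 0 0) <= c * (K * u t 0 0).
    by rewrite ler_wpM2l ?ler_wpM2r// ltW.
  have h4 : c * (K * u t 0 0) = al * k3 * u t 0 0 - k3 * (c * u t 0 0).
    by rewrite -cE; ring.
  rewrite -subr_ge0.
  rewrite (_ : _ - _ = al * k3 * u t 0 0 - k3 * (c * u t 0 0) - c * (k * u t 0 0)
     + c * (u t 0 0 * u t 0 1)); last by ring.
  by rewrite addr_ge0// -h4 subr_ge0.
- move=> T T0; exists (c * (b * expR (K * T))) => p u up pb.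
  apply: (@le_trans _ _ (c * u T 0 0)); first by rewrite lerBlDr lerDl (solution_ge0 up).
  rewrite ler_wpM2l ?(ltW c0)//.
  exact: (solution_le_exp hk3 hk5 up _ kK K0 pb T0).
Qed.

(** Once y >= c x - d, any x above K / c + e has k - y <= - d with
d = c e / 2, so that x decreases at a positive speed until it is below. *)
Lemma eventually_x_le b : eventually_le b (fun p => p 0 0) (K / c).
Proof.
move=> e e0; pose d := c * e / 2.
have d0 : 0 < d by rewrite divr_gt0// mulr_gt0.
have [T T0 hT] := @eventually_y_ge b d d0.
pose m := K / c + e; have m0 : 0 < m by rewrite ltr_wpDl// divr_ge0// ltW.
have cm : c * m = K + 2 * d by rewrite /m /d; field; exact: lt0r_neq0.
pose C := Num.max 0 b * expR (K * T).
have C0 : 0 <= C by rewrite mulr_ge0 ?expR_ge0// le_max lexx.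
have s0 : 0 <= C / (d * m) by rewrite divr_ge0// mulr_ge0// ltW.
exists (T + C / (d * m)) => [|p u up pb t Tt]; first by rewrite addr_ge0.
have Tt' : T <= t by apply: le_trans Tt; rewrite lerDl.
rewrite -/m leNgt; apply/negP => mx.
have drop r : T < r -> r < t -> m < u r 0 0 ->
    k * u r 0 0 - u r 0 0 * u r 0 1 <= - (d * m).
  move=> Tr rt mr.
  have yx := hT p u up pb r (ltW Tr).
  have r0 := le_lt_trans T0 Tr.
  have neg : k - u r 0 1 <= - d.
    have : c * m <= c * u r 0 0 by rewrite ler_wpM2l ?(ltW c0)// ltW.
    by move: yx kK; rewrite cm add0r; lra.
  rewrite (_ : _ - _ = u r 0 0 * (k - u r 0 1)); last by ring.
  apply: (@le_trans _ _ (u r 0 0 * - d)).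
    by rewrite ler_wpM2l// (solution_ge0 up) ?(ltW r0).
  by rewrite mulrN lerN2 mulrC ler_wpM2r ?(ltW d0)// ltW.
have := raydiff_trap (solution_x up) T0 Tt' (ltW (mulr_gt0 d0 m0)) drop mx.
apply/negP; rewrite -ltNge; apply: le_lt_trans (lt_trans m0 mx); rewrite subr_le0.
apply: (@le_trans _ _ C).
  apply: (le_trans (solution_x_le_exp up kK T0)); rewrite ler_wpM2r ?expR_ge0//.
  by rewrite le_max pb orbT.
by rewrite [leRHS]mulrC -(ler_pdivrMr _ _ (mulr_gt0 d0 m0)) lerBrDl.
Qed.

Lemma eventually_z_le b : eventually_le b (fun p => p 0 2) (K / c).
Proof.
apply: (eventually_le_relax hk5 _ _ (@eventually_x_le b)).
- by move=> p u up; eexists; first exact: solution_z up.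
- move=> T T0; exists (b * expR (K * T)) => p u up pb.
  exact: (solution_le_exp hk3 hk5 up _ kK K0 pb T0).
Qed.

Lemma eventually_y_le b : eventually_le b (fun p => p 0 1) (K / c).
Proof.
apply: (eventually_le_relax hk3 _ _ (@eventually_z_le b)).
- by move=> p u up; eexists; first exact: solution_y up.
- move=> T T0; exists (b * expR (K * T)) => p u up pb.
  exact: (solution_le_exp hk3 hk5 up _ kK K0 pb T0).
Qed.

Lemma attractor_bound_ge0 : 0 <= attractor_bound.
Proof. by rewrite divr_ge0// ltW. Qed.

Lemma attractor_bound_le0 : k <= 0 -> attractor_bound = 0.
Proof. by move=> k0; rewrite /attractor_bound /growth_rate max_r// mul0r. Qed.

Lemma attractor_bound_gt0 : 0 < k ->
  attractor_bound = k * (k + k5) * (k + k3) / (k3 * k5).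
Proof.
move=> k0; rewrite /attractor_bound /yx_ratio /zx_ratio /growth_rate max_l ?(ltW k0)//.
field; rewrite !lt0r_neq0 ?addr_gt0//.
Qed.

Lemma flow_eventually_le b e : 0 < e -> exists2 T, 0 <= T &
  forall t p, T <= t -> orthant p -> (forall i, p 0 i <= b) ->
    forall i, flow t p 0 i <= attractor_bound + e.
Proof.
move=> e0.
have [T1 T10 h1] := @eventually_x_le b e e0.
have [T2 T20 h2] := @eventually_y_le b e e0.
have [T3 T30 h3] := @eventually_z_le b e e0.
exists (Num.max T1 (Num.max T2 T3)) => [|t p]; first by rewrite le_max T10.
rewrite !ge_max => /and3P[t1 t2 t3] p0 pb.
have up := flow_solution k hk3 hk5 p0.
by apply: forall_ord3; [exact: h1 up pb t t1|exact: h2 up pb t t2|exact: h3 up pb t t3].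
Qed.

Lemma bounded_rV_le (B : set 'rV[R]_3) : bounded_set B ->
  exists b, forall p i, B p -> p 0 i <= b.
Proof.
move=> /pinfty_ex_gt0[b _ hb]; exists b => p i Bp.
have /rV_norm_le : `|p| <= b by exact: hb.
move=> /(_ (le_trans (normr_ge0 _) (hb p Bp))) /(_ i).
exact/le_trans/ler_norm.
Qed.

Definition cube (m : R) : set 'rV[R]_3 := [set p | forall i, 0 <= p 0 i <= m].

Lemma cube_orthant m : cube m `<=` @orthant R.
Proof. by move=> p h i; have /andP[] := h i. Qed.

Lemma cube_compact m : compact (cube m).
Proof.
have := @rV_compact _ 3 (fun=> `[0, m]%classic) (fun=> @segment_compact _ 0 m).
by congr compact; apply/seteqP; split=> p h i; have := h i; rewrite /= in_itv.
Qed.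

Lemma attracts_of_uniform (A B : set 'rV[R]_3) :
  (forall e : R, 0 < e -> exists2 s, 0 <= s & forall t p, s <= t -> B p ->
     exists2 a, A a & ball a e (flow t p)) -> attracts flow A B.
Proof.
move=> h; rewrite /attracts.
set S := fun t => ereal_sup _.
have S0 t : (0 <= S t)%E by apply: ereal_sup_ubound; left.
have Sle e : 0 < e -> \forall t \near +oo, (S t <= e%:E)%E.
  move=> e0; have [s s0 hs] := h e e0; near=> t.
  apply: ub_ereal_sup => _ [->|[p Bp <-]]; first by rewrite lee_fin ltW.
  have [|a Aa ha] := hs t p _ Bp; first by near: t; apply: nbhs_pinfty_ge; exact: num_real.
  have : (edist (flow t p, a) <= e%:E)%E by apply: edist_fin => //; exact: ball_sym.
  apply: le_trans.
  by apply: ereal_inf_lbound; exists a.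
have Sfin t e : (S t <= e%:E)%E -> S t \is a fin_num.
  by move=> Se; rewrite ge0_fin_numE// (le_lt_trans Se)// ltry.
apply/fine_cvgP; split.
  by apply: filterS (Sle 1 ltr01) => t; exact: Sfin.
apply/cvgrPdist_le => e e0; apply: filterS (Sle e e0) => t Se /=.
rewrite sub0r normrN ger0_norm ?fine_ge0// -lee_fin fineK//; exact: Sfin Se.
Unshelve. all: by end_near. Qed.

End Dissipativity.

(** * The global attractor *)

Theorem theorem1p3 (R : realType) (k k3 k5 : R) (hk3 : 0 < k3) (hk5 : 0 < k5) :
  exists A : set 'rV[R]_3,
    [/\ A !=set0, compact A, A `<=` @orthant R,
        invariant_set (flow k k3 k5) A &
        (forall B : set 'rV[R]_3, B `<=` @orthant R -> bounded_set B ->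
          attracts (flow k k3 k5) A B)] /\
    (k <= 0 -> A = [set 0]) /\
    (0 < k -> A `<=` [set p : 'rV[R]_3 | forall i : 'I_3,
       0 <= p 0 i <= k * (k + k5) * (k + k3) / (k3 * k5)]).
Proof.
pose M := attractor_bound k k3 k5.
have M0 : 0 <= M by exact: attractor_bound_ge0.
pose phi := flow k k3 k5.
have [] := @attractor_of_absorbing R _ (@orthant R) (cube (M + 1)) phi
  (fun B => bounded_set B).
- exact: norm_hausdorff.
- by move=> p t p0; exact: flow_orthant.
- by move=> p; exact: flow0.
- by move=> p s t; exact: flowD.
- by move=> t; exact: flow_continuous.
- exact: cube_compact.
- by exists 0 => i; rewrite mxE lexx addr_ge0.
- exact: cube_orthant.
- exact/compact_bounded/cube_compact.
- move=> B B0 /bounded_rV_le[b hb].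
  have [T T0 hT] := flow_eventually_le k hk3 hk5 b (ltr01 : 0 < 1 :> R).
  exists T => // t p Tt Bp i; have p0 := B0 p Bp; apply/andP; split.
    by apply: flow_orthant => //; exact: le_trans Tt.
  by apply: (hT t p Tt p0) => j; exact: hb.
move=> A [A0 Ac AK Ainv Aattr].
have AM : A `<=` cube M.
  move=> p Ap i; apply/andP; split.
    have [q /cube_orthant q0 <-] := AK 0 (lexx _) p Ap.
    by rewrite /phi flow0.
  apply/ler_addgt0Pr => e e0.
  have [T T0 hT] := flow_eventually_le k hk3 hk5 (M + 1) e0.
  have [q Kq <-] := AK T T0 p Ap.
  apply: hT => //; first exact: cube_orthant Kq.
  by move=> j; have /andP[] := Kq j.
exists A; split; last split.
- split=> //; first by move=> p /AM; exact: cube_orthant.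
  by move=> B B0 Bb; apply: attracts_of_uniform => e; exact: Aattr.
- move=> k0; have A00 : A `<=` [set 0].
    move=> p /AM pM; apply/rowP => i; apply/eqP; rewrite mxE eq_le.
    by rewrite -[X in _ <= X](attractor_bound_le0 k3 k5 k0) -/M andbC; exact: pM.
  apply/seteqP; split=> // p ->; have [q Aq] := A0.
  by rewrite -(A00 q Aq).
- by move=> k0; rewrite -attractor_bound_gt0.
Qed.
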